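(* Let $p \in [1,\infty]$. Given a metric pair $(X,d,A)$, the tuple $(D(X,A),W_p[d,A],+,0)$ is a $p$-subadditive commutative metric monoid, and the canonical inclusion $i:(X,d,A) \to (D(X,A),W_p[d,A],0)$ is $1$-Lipschitz. Furthermore, this construction is functorial: sending $(X,d,A)$ to $(D(X,A),W_p[d,A],+,0)$ and a morphism of metric pairs $f:(X,d,A)\to (Y,d',B)$ to $f_*:(D(X,A),W_p[d,A],+,0)\to (D(Y,B),W_p[d',B],+,0)$ defines a functor $\overline{D}_p$ from the category of metric pairs to the category of $p$-subadditive commutative metric monoids.
   Context: A metric space is a pair $(X,d)$ with $X$ a set and $d:X\times X\to[0,\infty]$ satisfying $d(x,x)=0$, $d(x,y)=d(y,x)$ and $d(x,y)\le d(x,z)+d(z,y)$ (an extended pseudometric). A metric map ($1$-Lipschitz map) is a function $f$ with $d_Y(f(x),f(y))\le d_X(x,y)$. A metric pair $(X,d,A)$ is a metric space $(X,d)$ with a nonempty subset $A\subset X$; morphisms $f:(X,d,A)\to(Y,d',B)$ are metric maps with $f(A)\subset B$. A pointed metric space $(X,d,x_0)$ is a metric pair with $A=\{x_0\}$; pointed metric maps are morphisms of these as pairs. The $p$-norms $\|\cdot\|_p$ are the usual ones on finite tuples ($\max$ of absolute values for $p=\infty$), extended to entries in $[0,\infty]$. A $p$-subadditive commutative metric monoid is a tuple $(M,d,+,0)$ with $(M,d,0)$ a pointed metric space and $(M,+,0)$ a commutative monoid such that $d(a+b,a'+b')\le\|(d(a,a'),d(b,b'))\|_p$ for all $a,b,a',b'\in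 M$. Its morphisms (metric monoid homomorphisms) are pointed metric maps that are monoid homomorphisms. $D(X)$ is the free commutative monoid on $X$ (finite formal sums of elements of $X$). $D(X,A):=D(X)/D(A)$ is the quotient monoid, where $\alpha\sim\beta$ iff $\alpha+\xi=\beta+\eta$ for some $\xi,\eta\in D(A)$; thus $D(X,A)\cong D(X\setminus A)$. The canonical inclusion $i:X\to D(X,A)$ sends $x$ to the class of the formal sum $x$ (so $i(A)=\{0\}$). For $f:(X,A)\to(Y,B)$, $f_*:D(X,A)\to D(Y,B)$ is $f_*(x_1+\cdots+x_n)=f(x_1)+\cdots+f(x_n)$. The $p$-Wasserstein distance $W_p=W_p[d,A]$ on $D(X,A)$ is $$W_p[d,A](x_1+\cdots+x_m,\,x_1'+\cdots+x_n')=\inf\big\|(d(x_k,x'_{\sigma(k)}))_{k=1}^{m+n}\big\|_p,$$ the infimum being over all $x_{m+1},\ldots,x_{m+n},x'_{n+1},\ldots,x'_{n+m}\in A$ and all permutations $\sigma\in\Sigma_{m+n}$. *)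

(* Defs.v *)
From HB Require Import structures.
From mathcomp Require Import all_boot all_order all_algebra.
From mathcomp Require Import perm finmap multiset zify.
From mathcomp Require Import all_classical all_reals all_analysis.

Set Implicit Arguments.
Unset Strict Implicit.
Unset Printing Implicit Defensive.

Import Order.TTheory GRing.Theory Num.Theory.

Local Open Scope classical_set_scope.
Local Open Scope ereal_scope.
Local Open Scope ring_scope.

Record category := Category {
  ob :> Type;
  hom : ob -> ob -> Type;
  idm : forall x, hom x x;
  compm : forall x y z, hom y z -> hom x y -> hom x z;
  comp_idl : forall x y (f : hom x y), compm (idm y) f = f;
  comp_idr : forall x y (f : hom x y), compm f (idm x) = f;
  compA : forall w x y z (h : hom y z) (g : hom x y) (f : hom w x),
    compm h (compm g f) = compm (compm h g) f }.

Arguments idm {c} x.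
Arguments compm {c x y z} g f.

Definition is_functor (C D : category) (F : C -> D)
    (Fmap : forall x y : C, hom x y -> hom (F x) (F y)) : Prop :=
  (forall x : C, Fmap x x (idm x) = idm (F x)) /\
  (forall (x y z : C) (g : hom y z) (f : hom x y),
     Fmap x z (compm g f) = compm (Fmap y z g) (Fmap x y f)).

(* Distances may vanish off the diagonal and may be infinite. *)
Record is_metric (R : realType) (X : Type) (d : X -> X -> \bar R) : Prop := {
  metric_ge0 : forall x y, (0 <= d x y)%E;
  metric_refl : forall x, d x x = 0%E;
  metric_sym : forall x y, d x y = d y x;
  metric_triangle : forall x y z, (d x y <= d x z + d z y)%E }.

Definition metric_map (R : realType) (X Y : Type) (dX : X -> X -> \bar R)
    (dY : Y -> Y -> \bar R) (f : X -> Y) : Prop :=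
  forall x y, (dY (f x) (f y) <= dX x y)%E.

Definition is_pair_map (R : realType) (X Y : Type) (dX : X -> X -> \bar R)
    (A : set X) (dY : Y -> Y -> \bar R) (B : set Y) (f : X -> Y) : Prop :=
  metric_map dX dY f /\ f @` A `<=` B.

Record metric_pair (R : realType) := MetricPair {
  pair_sort :> Type;
  pair_dist : pair_sort -> pair_sort -> \bar R;
  pair_sub : set pair_sort;
  pair_metric : is_metric pair_dist;
  pair_sub_neq0 : pair_sub !=set0 }.

Arguments pair_dist {R} _ _ _.
Arguments pair_sub {R} _ _.

Record pair_map (R : realType) (P Q : metric_pair R) := PairMap {
  pair_fun :> P -> Q;
  pair_funP : is_pair_map (pair_dist P) (pair_sub P)
                          (pair_dist Q) (pair_sub Q) pair_fun }.

Section MetricPairCategory.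
Context (R : realType).
Implicit Types P Q S : metric_pair R.

Lemma pair_map_eq P Q (f g : pair_map P Q) : f =1 g -> f = g.
Proof.
case: f g => [f fP] [g gP] /= /funext fg.
by case: _ / fg gP => gP; rewrite (Prop_irrelevance fP gP).
Qed.

Lemma pair_map_id_proof P :
  is_pair_map (pair_dist P) (pair_sub P)
              (pair_dist P) (pair_sub P) id.
Proof. by split=> [x y|_ [x Ax <-]]. Qed.

Definition pair_map_id P := PairMap (pair_map_id_proof P).

Lemma pair_map_comp_proof P Q S (g : pair_map Q S) (f : pair_map P Q) :
  is_pair_map (pair_dist P) (pair_sub P)
              (pair_dist S) (pair_sub S) (g \o f).
Proof.
have [[gm gA] [fm fA]] := (pair_funP g, pair_funP f).
split=> [x y|_ [x Ax <-]]; first exact: le_trans (gm _ _) (fm _ _).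
by apply: gA; exists (f x) => //; apply: fA; exists x.
Qed.

Definition pair_map_comp P Q S (g : pair_map Q S) (f : pair_map P Q) :=
  PairMap (pair_map_comp_proof g f).

Definition metric_pairs : category.
Proof.
by refine (@Category (metric_pair R) (@pair_map R) pair_map_id pair_map_comp
  _ _ _) => *; apply: pair_map_eq.
Defined.

End MetricPairCategory.

(* The value at p = -oo is junk. *)
Definition pnorm (R : realType) (p : \bar R) (v : seq (\bar R)) : \bar R :=
  match p with
  | r%:E => poweR (\sum_(x <- v) poweR `|x| r)%E r^-1
  | +oo%E => \big[maxe/0%E]_(x <- v) `|x|%E
  | -oo%E => 0%E
  end.

Definition is_psubadditive (R : realType) (p : \bar R) (M : nmodType)
    (d : M -> M -> \bar R) : Prop :=
  is_metric d /\
  (forall a b a' b' : M,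
     (d (a + b)%R (a' + b')%R <= pnorm p [:: d a a'; d b b'])%E).

Definition is_metric_monoid_hom (R : realType) (M N : nmodType)
    (dM : M -> M -> \bar R) (dN : N -> N -> \bar R) (f : M -> N) : Prop :=
  is_pair_map dM [set 0] dN [set 0] f /\ GRing.nmod_morphism f.

Record metric_monoid (R : realType) (p : \bar R) := MetricMonoid {
  monoid_sort :> nmodType;
  monoid_dist : monoid_sort -> monoid_sort -> \bar R;
  monoid_psubadditive : is_psubadditive p monoid_dist }.

Arguments monoid_dist {R p} _ _ _.

Record metric_monoid_hom (R : realType) (p : \bar R) (M N : metric_monoid p) :=
  MetricMonoidHom {
    monoid_fun :> M -> N;
    monoid_funP : is_metric_monoid_hom (monoid_dist M)
                                       (monoid_dist N) monoid_fun }.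

Section MetricMonoidCategory.
Context (R : realType) (p : \bar R).
Implicit Types M N K : metric_monoid p.

Lemma metric_monoid_hom_eq M N (f g : metric_monoid_hom M N) :
  f =1 g -> f = g.
Proof.
case: f g => [f fP] [g gP] /= /funext fg.
by case: _ / fg gP => gP; rewrite (Prop_irrelevance fP gP).
Qed.

Lemma metric_monoid_id_proof M :
  is_metric_monoid_hom (monoid_dist M) (monoid_dist M) id.
Proof. by split=> //; split=> [x y|_ [x Ax <-]]. Qed.

Definition metric_monoid_id M := MetricMonoidHom (metric_monoid_id_proof M).

Lemma metric_monoid_comp_proof M N K
    (g : metric_monoid_hom N K) (f : metric_monoid_hom M N) :
  is_metric_monoid_hom (monoid_dist M) (monoid_dist K) (g \o f).
Proof.
have [[gm [g0 gD]] [fm [f0 fD]]] := (monoid_funP g, monoid_funP f).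
split; last by split=> [|x y] /=; rewrite ?f0 ?g0 ?fD ?gD.
split=> [x y|_ [x -> <-]]; last by rewrite /= f0 g0.
exact: le_trans (gm.1 _ _) (fm.1 _ _).
Qed.

Definition metric_monoid_comp M N K
    (g : metric_monoid_hom N K) (f : metric_monoid_hom M N) :=
  MetricMonoidHom (metric_monoid_comp_proof g f).

Definition metric_monoids : category.
Proof.
by refine (@Category (metric_monoid p) (@metric_monoid_hom R p)
  metric_monoid_id metric_monoid_comp _ _ _) => *;
  apply: metric_monoid_hom_eq.
Defined.

End MetricMonoidCategory.

(* D(X): a formal sum is a finite multiset, with multiset union as addition. *)
Notation formal_sum X := {mset {classic X}}%mset.

Section RelativeFreeMonoid.
Context (X : Type) (A : set X).
Implicit Types alpha beta xi eta : formal_sum X.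

Definition supported_in xi : Prop := forall x : {classic X}, x \in xi -> A x.

Definition sum_equiv alpha beta : bool :=
  `[< exists xi eta, [/\ supported_in xi, supported_in eta &
        (alpha `+` xi)%mset = (beta `+` eta)%mset] >].

Lemma sum_equiv_refl : reflexive sum_equiv.
Proof.
move=> alpha; apply/asboolP; exists mset0, mset0.
by split=> // x; rewrite in_mset0.
Qed.

Lemma sum_equiv_sym : symmetric sum_equiv.
Proof.
have impl alpha beta : sum_equiv alpha beta -> sum_equiv beta alpha.
  by move=> /asboolP[xi [eta [Axi Aeta e]]]; apply/asboolP; exists eta, xi.
by move=> alpha beta; apply/idP/idP; apply: impl.
Qed.

Lemma supported_inD xi eta :
  supported_in xi -> supported_in eta -> supported_in (xi `+` eta)%mset.
Proof. by move=> Axi Aeta x /msetDP[/Axi|/Aeta]. Qed.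

Lemma sum_equiv_trans : transitive sum_equiv.
Proof.
move=> beta alpha gamma /asboolP[xi [eta [Axi Aeta e]]].
move=> /asboolP[xi' [eta' [Axi' Aeta' e']]]; apply/asboolP.
exists (xi `+` xi')%mset, (eta `+` eta')%mset.
split; [exact: supported_inD | exact: supported_inD |].
by rewrite msetDA e msetDAC e' -msetDA [(eta' `+` _)%mset]msetDC.
Qed.

Canonical sum_equivR :=
  EquivRel sum_equiv sum_equiv_refl sum_equiv_sym sum_equiv_trans.

Definition rel_monoid : Type := {eq_quot sum_equiv}%qT.

HB.instance Definition _ := EqQuotient.on rel_monoid.
HB.instance Definition _ := Choice.on rel_monoid.

Definition rel_class alpha : rel_monoid := (\pi_rel_monoid alpha)%qT.

Definition rel_zero : rel_monoid := rel_class mset0.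

Definition rel_add (a b : rel_monoid) : rel_monoid :=
  rel_class (repr a `+` repr b)%mset.

Lemma rel_classK : cancel repr rel_class.
Proof. exact: reprK. Qed.

Lemma rel_eqP alpha beta :
  reflect (exists xi eta, [/\ supported_in xi, supported_in eta &
             (alpha `+` xi)%mset = (beta `+` eta)%mset])
          (rel_class alpha == rel_class beta).
Proof. by rewrite /rel_class piE; apply: asboolP. Qed.

Lemma rel_addE alpha beta :
  rel_add (rel_class alpha) (rel_class beta) = rel_class (alpha `+` beta)%mset.
Proof.
have [xi [eta [Axi Aeta e]]] : exists xi eta,
    [/\ supported_in xi, supported_in eta &
      (repr (rel_class alpha) `+` xi)%mset = (alpha `+` eta)%mset].
  by apply/rel_eqP; rewrite rel_classK.
have [xi' [eta' [Axi' Aeta' e']]] : exists xi eta,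
    [/\ supported_in xi, supported_in eta &
      (repr (rel_class beta) `+` xi)%mset = (beta `+` eta)%mset].
  by apply/rel_eqP; rewrite rel_classK.
apply/eqP/rel_eqP; exists (xi `+` xi')%mset, (eta `+` eta')%mset.
split; [exact: supported_inD | exact: supported_inD |].
by rewrite msetDACA e e' msetDACA.
Qed.

Lemma rel_addA : associative rel_add.
Proof.
move=> a b c; rewrite -[a]rel_classK -[b]rel_classK -[c]rel_classK.
by rewrite !rel_addE msetDA.
Qed.

Lemma rel_addC : commutative rel_add.
Proof. by move=> a b; rewrite /rel_add msetDC. Qed.

Lemma rel_add0 : left_id rel_zero rel_add.
Proof. by move=> a; rewrite -[a]rel_classK rel_addE mset0D. Qed.

HB.instance Definition _ :=
  GRing.isNmodule.Build rel_monoid rel_addA rel_addC rel_add0.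

Definition sum_class (s : seq X) : rel_monoid :=
  rel_class (seq_mset (s : seq {classic X})).

Definition rel_incl (x : X) : rel_monoid := sum_class [:: x].

(* The terms of a chosen representative of a class. *)
Definition terms (a : rel_monoid) : seq X := (repr a : seq {classic X}).

Lemma termsK : cancel terms sum_class.
Proof. by move=> a; rewrite /sum_class /terms seq_mset_id rel_classK. Qed.

Lemma supported_inP (u : seq {classic X}) :
  reflect (supported_in (seq_mset u)) (all (mem A) u).
Proof.
apply: (iffP (@allP {classic X} (mem A) u)) => Au x xu; last first.
  by apply/mem_set/Au; rewrite (perm_mem (perm_eq_seq_mset u)).
by apply/set_mem/Au; rewrite -(perm_mem (perm_eq_seq_mset u)).
Qed.

Lemma seq_mset_cat (s t : seq {classic X}) :
  seq_mset (s ++ t) = (seq_mset s `+` seq_mset t)%mset.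
Proof. by apply/msetP => x; rewrite msetE2 !mset_seqE count_cat. Qed.

Lemma sum_class_cat (s t : seq X) :
  sum_class (s ++ t) = (sum_class s + sum_class t)%R.
Proof. by rewrite /sum_class seq_mset_cat; apply/esym/rel_addE. Qed.

Lemma sum_class_nil : sum_class [::] = 0%R.
Proof.
by congr rel_class; apply/msetP => x; rewrite mset_seqE mset0E.
Qed.

Lemma sum_classE (s : seq X) : sum_class s = (\sum_(x <- s) rel_incl x)%R.
Proof.
elim: s => [|x s IHs]; first by rewrite big_nil sum_class_nil.
by rewrite big_cons -IHs -sum_class_cat.
Qed.

Lemma sum_class_eqP (s t : seq {classic X}) :
  sum_class s = sum_class t <->
  exists u v : seq {classic X},
    [/\ all (mem A) u, all (mem A) v & perm_eq (s ++ u) (t ++ v)].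
Proof.
split=> [/eqP/rel_eqP[xi [eta [Axi Aeta e]]]|[u [v [Au Av e]]]].
  exists xi, eta; split.
  - by apply/supported_inP; rewrite seq_mset_id.
  - by apply/supported_inP; rewrite seq_mset_id.
  - by apply/eq_seq_msetP; rewrite !seq_mset_cat !seq_mset_id.
apply/eqP/rel_eqP; exists (seq_mset u), (seq_mset v).
split; [exact/supported_inP | exact/supported_inP |].
by rewrite -!seq_mset_cat; apply/eq_seq_msetP.
Qed.

End RelativeFreeMonoid.

(* Given on a representative; see rel_pushE for arbitrary sums. *)
Definition rel_push (X Y : Type) (A : set X) (B : set Y) (f : X -> Y)
    (a : rel_monoid A) : rel_monoid B :=
  sum_class B (map f (terms a)).

Arguments rel_push {X Y} A B f a.

Lemma rel_pushE (X Y : Type) (A : set X) (B : set Y) (f : X -> Y)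
    (s : seq X) :
  f @` A `<=` B -> rel_push A B f (sum_class A s) = sum_class B (map f s).
Proof.
move=> fAB.
have [u [v [Au Av e]]] := (sum_class_eqP A _ s).1 (termsK (sum_class A s)).
have fA w : all (mem A) w -> all (mem B) (map f w).
  elim: w => //= x w IHw /andP[Ax /IHw->]; rewrite andbT.
  by apply/mem_set/fAB; exists x => //; apply: set_mem.
apply/(sum_class_eqP B (map f (terms (sum_class A s)) : seq {classic Y})).
exists (map f u), (map f v); split; [exact: fA | exact: fA |].
by rewrite -!map_cat; apply: (@perm_map {classic X} {classic Y}).
Qed.

Section Wasserstein.
Context (R : realType) (p : \bar R) (X : Type) (d : X -> X -> \bar R).
Context (A : set X).

Definition padding (s x : seq X) : Prop :=
  exists2 u : seq X, all (mem A) u & x = s ++ u.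

(* Since x has size s + size t entries, it extends s by size t elements of A;
   likewise x' extends t by size s elements of A. *)
Definition matching_costs (s t : seq X) : set (\bar R) :=
  [set c | exists (x x' : (size s + size t).-tuple X)
                  (sigma : 'S_(size s + size t)),
     [/\ padding s x, padding t x' &
         c = pnorm p [seq d (tnth x k) (tnth x' (sigma k))
                     | k : 'I_(size s + size t)]]].

Definition matching_dist (s t : seq X) : \bar R :=
  ereal_inf (matching_costs s t).

(* See wassersteinE for the independence from the representatives. *)
Definition wasserstein (a b : rel_monoid A) : \bar R :=
  matching_dist (terms a) (terms b).

End Wasserstein.

Arguments wasserstein {R} p {X} d A a b.

Section WassersteinTheory.
Context (R : realType) (p : \bar R) (X : Type) (d : X -> X -> \bar R).
Context (A : set X).
Hypotheses (p1 : (1 <= p)%E) (dP : is_metric d) (A0 : A !=set0).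
Let X' : choiceType := {classic X}.
Implicit Types (s t u v : seq X') (c : seq (X' * X')).

Lemma perm_pnorm (v w : seq (\bar R)) :
  perm_eq v w -> pnorm p v = pnorm p w.
Proof. by move: p => [r| |] //= vw; rewrite (perm_big _ vw). Qed.

Lemma pnorm_cons0 (v : seq (\bar R)) : pnorm p (0%E :: v) = pnorm p v.
Proof.
move: p p1 => [r| |] //= r1; rewrite big_cons abse0; last first.
  rewrite max_r//; elim/big_rec: _ => // x y _ y0.
  by rewrite le_max y0 orbT.
rewrite poweR_EFin powR0 ?add0e//.
by rewrite gt_eqF// (lt_le_trans ltr01).
Qed.

Lemma le_pnorm_cons (x : \bar R) (v : seq (\bar R)) :
  (pnorm p v <= pnorm p (x :: v))%E.
Proof.
move: p p1 => [r| |] //= r1; rewrite big_cons; last by rewrite le_max lexx orbT.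
have r0 : (0 <= r)%R by rewrite (le_trans ler01).
have S0 : (0 <= \sum_(y <- v) poweR `|y| r)%E.
  by apply: sume_ge0 => y _; exact: poweR_ge0.
apply: gt0_ler_poweR.
- by rewrite invr_ge0.
- by rewrite in_itv/= S0 leey.
- by rewrite in_itv/= leey andbT adde_ge0// poweR_ge0.
- by rewrite leeDr// poweR_ge0.
Qed.

(* The amount of padding is unconstrained here, unlike in matching_costs; this
   does not change the infimum (matching_distE). *)
Definition is_matching s t c : Prop := exists u v,
  [/\ all (mem A) u, all (mem A) v,
      perm_eq (unzip1 c) (s ++ u) & perm_eq (unzip2 c) (t ++ v)].

Definition matching_cost c : \bar R := pnorm p [seq d x.1 x.2 | x <- c].

Lemma matching_costs_matching s t b :
  matching_costs p d A s t b ->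
  exists2 c, is_matching s t c & matching_cost c = b.
Proof.
move=> [x [x' [sigma [[u Au xE] [v Av x'E] ->]]]].
exists [seq (tnth x k : X', tnth x' (sigma k) : X')
       | k : 'I_(size s + size t)]; last first.
  by rewrite /matching_cost /image_mem -map_comp.
exists u, v; split=> //.
- by rewrite /unzip1 -map_comp -xE map_tnth_enum.
- rewrite /unzip2 -map_comp -x'E perm_sym.
  pose y : (size s + size t).-tuple X' :=
    [tuple tnth x' (sigma k) | k < size s + size t].
  rewrite perm_sym.
  have -> : map ((fun x0 : X' * X' => x0.2) \o
      (fun k => (tnth x k : X', tnth x' (sigma k) : X')))
      (enum 'I_(size s + size t)) = y.
    by rewrite /= /y /=.
  by apply/tuple_permP; exists sigma.
Qed.

Lemma perm_map_lift (T U : eqType) (f : T -> U) (c : seq T) (w : seq U) :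
  perm_eq w (map f c) -> exists2 c', perm_eq c' c & map f c' = w.
Proof.
case: c => [/perm_nilP->|z c wc]; first by exists [::].
have [Is] := perm_iotaP (f z) wc; rewrite size_map => Isp ->.
exists (map (nth z (z :: c)) Is).
  by apply/(perm_iotaP z); exists Is.
rewrite -map_comp; apply/eq_in_map => i.
rewrite (perm_mem Isp) mem_iota add0n => /andP[_ ic].
by rewrite (nth_map z (f z)).
Qed.

Lemma matching_matching_costs s t c :
  is_matching s t c -> size c = (size s + size t)%N ->
  matching_costs p d A s t (matching_cost c).
Proof.
move=> [u [v [Au Av cu cv]]] cst.
have [c' c'c c'E] : exists2 c', perm_eq c' c & unzip1 c' = s ++ u.
  by apply: perm_map_lift; rewrite perm_sym.
have sx : size (s ++ u) == (size s + size t)%N.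
  by rewrite -(perm_size cu) size_map cst.
have sx' : size (t ++ v) == (size s + size t)%N.
  by rewrite -(perm_size cv) size_map cst.
have sz : size (unzip2 c') == (size s + size t)%N.
  by rewrite size_map (perm_size c'c) cst.
have [sigma sigmaE] : exists sigma : 'S_(size s + size t),
    unzip2 c' = [tuple tnth (Tuple sx') (sigma k) | k < size s + size t].
  apply/(@tuple_permP _ _ (Tuple sz) (Tuple sx')) => /=.
  by rewrite (permPl (perm_map _ c'c)).
exists (Tuple sx), (Tuple sx'), sigma; split; [by exists u|by exists v|].
rewrite /matching_cost (perm_pnorm (perm_map _ (_ : perm_eq c c'))); last first.
  by rewrite perm_sym.
congr pnorm.
have -> : c' = zip (unzip1 c') (unzip2 c') by rewrite zip_unzip.
have xE : s ++ u = map (tnth (Tuple sx)) (enum 'I_(size s + size t)).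
  by rewrite map_tnth_enum.
by rewrite c'E sigmaE [in LHS]xE /= zip_map -map_comp.
Qed.

Lemma matching_pad s t c a : A a ->
  is_matching s t c -> is_matching s t ((a, a) :: c).
Proof.
move=> Aa [u [v [Au Av cu cv]]]; exists (a :: u), (a :: v).
have aA : a \in A by exact: mem_set.
split=> /=; rewrite ?aA// perm_sym -cat1s perm_catCA perm_cons perm_sym//.
Qed.

Lemma matching_cost_pad c a : matching_cost ((a, a) :: c) = matching_cost c.
Proof. by rewrite /matching_cost /= metric_refl// pnorm_cons0. Qed.

Lemma matching_shrink s t c :
  is_matching s t c -> (size s + size t < size c)%N ->
  exists2 c', is_matching s t c' &
    size c = (size c').+1 /\ (matching_cost c' <= matching_cost c)%E.
Proof.
move=> [u [v [Au Av cu cv]]] stc.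
have [c' c'c c'E] : exists2 c', perm_eq c' c & unzip1 c' = s ++ u.
  by apply: perm_map_lift; rewrite perm_sym.
pose c2 := drop (size s) c'.
have c2u : unzip1 c2 = u.
  by rewrite /unzip1 map_drop -/(unzip1 c') c'E drop_size_cat.
have [y yc2] : exists y, (count_mem y t < count_mem y (unzip2 c2))%N.
  apply: contrapT => /forallNP yc2.
  have /count_subseqP[w wt /perm_size] : forall y,
      (count_mem y (unzip2 c2) <= count_mem y t)%N.
    by move=> y; rewrite leqNgt; apply/negP; exact: yc2.
  move=> c2w; move: (size_subseq wt); rewrite -c2w size_map size_drop.
  by rewrite (perm_size c'c) leqNgt ltn_subRL stc.
have c'v : perm_eq (unzip2 c') (t ++ v) by rewrite (permPl (perm_map _ c'c)).
have yv : y \in v.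
  rewrite -has_pred1 has_count -(ltn_add2l (count_mem y t)) addn0.
  rewrite -count_cat -(seq.permP c'v); apply: leq_trans yc2 _.
  rewrite -[in leqRHS](cat_take_drop (size s) c') /unzip2 map_cat.
  by rewrite count_cat leq_addl.
have : y \in unzip2 c2 by rewrite -has_pred1 has_count (leq_ltn_trans _ yc2).
move=> /mapP[[x y'] xyc2 /= yE]; rewrite -{}yE in xyc2.
have xu : x \in u by rewrite -c2u; apply/mapP; exists (x, y).
have xyc : (x, y) \in c by rewrite -(perm_mem c'c) (mem_drop xyc2).
have all_rem (z : X') (w : seq X') :
    all (mem A) w -> all (mem A) (rem z w).
  by elim: w => //= a w IHw /andP[aA wA]; case: ifP => //= _; rewrite aA IHw.
have crem : perm_eq c ((x, y) :: rem (x, y) c) by exact: perm_to_rem.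
exists (rem (x, y) c).
  exists (rem x u), (rem y v); split.
  - by apply: all_rem.
  - by apply: all_rem.
  - rewrite -(perm_cons x) -[x :: unzip1 _]/(unzip1 ((x, y) :: rem (x, y) c)).
    rewrite -(permPl (perm_map _ crem)) (permPl cu).
    rewrite -[x :: (s ++ _)]cat1s perm_sym perm_catCA perm_cat2l.
    by rewrite perm_sym perm_to_rem.
  - rewrite -(perm_cons y) -[y :: unzip2 _]/(unzip2 ((x, y) :: rem (x, y) c)).
    rewrite -(permPl (perm_map _ crem)) (permPl cv).
    rewrite -[y :: (t ++ _)]cat1s perm_sym perm_catCA perm_cat2l.
    by rewrite perm_sym perm_to_rem.
split; first by rewrite (perm_size crem).
rewrite /matching_cost (perm_pnorm (perm_map _ crem)); exact: le_pnorm_cons.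
Qed.

Lemma matching_resize s t c : is_matching s t c ->
  exists2 c', is_matching s t c' &
    size c' = (size s + size t)%N /\ (matching_cost c' <= matching_cost c)%E.
Proof.
have [n] := ubnP (size c - (size s + size t))%N; elim: n c => // n IHn c cn cM.
have [stc|cst] := ltnP (size s + size t)%N (size c).
  have [c1 c1M [c1s c1c]] := matching_shrink cM stc.
  have [|c2 c2M [c2s c2c1]] := IHn c1 _ c1M.
    by rewrite -ltnS (leq_trans _ cn)// c1s subSn// -ltnS -c1s.
  by exists c2 => //; split=> //; exact: le_trans c1c.
have [a Aa] := A0; pose k := (size s + size t - size c)%N.
exists (nseq k (a, a) ++ c); last first.
  split; first by rewrite size_cat size_nseq subnK.
  by elim: k => //= k; rewrite matching_cost_pad.
by elim: k => //= k; exact: matching_pad.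
Qed.

Lemma matching_distE s t :
  matching_dist p d A s t =
  ereal_inf [set matching_cost c | c in is_matching s t].
Proof.
apply/eqP; rewrite eq_le; apply/andP; split; apply/ereal_infP => b.
  move=> [c cM <-]; have [c' c'M [c's c'c]] := matching_resize cM.
  by apply: ge_ereal_inf; exists (matching_cost c') => //;
    exact: matching_matching_costs.
move=> /matching_costs_matching[c cM <-].
by apply: ge_ereal_inf; exists (matching_cost c) => //; exists c.
Qed.

Lemma is_matching_sum_class s t s' t' c :
  sum_class A s = sum_class A s' -> sum_class A t = sum_class A t' ->
  is_matching s t c ->
  exists2 c', is_matching s' t' c' & matching_cost c' = matching_cost c.
Proof.
move=> /sum_class_eqP[e [e' [Ae Ae' se]]] /sum_class_eqP[f [f' [Af Af' tf]]].
move=> [u [v [Au Av cu cv]]].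
exists ([seq (a, a) | a <- e ++ f] ++ c); last first.
  by elim: (e ++ f) => //= a w; rewrite matching_cost_pad.
have diag1 (w : seq X') :
    unzip1 ([seq (a, a) | a <- w] ++ c) = w ++ unzip1 c.
  by elim: w => //= a w ->.
have diag2 (w : seq X') :
    unzip2 ([seq (a, a) | a <- w] ++ c) = w ++ unzip2 c.
  by elim: w => //= a w ->.
exists (e' ++ f ++ u), (f' ++ e ++ v); split.
- by rewrite !all_cat Ae' Af.
- by rewrite !all_cat Af' Ae.
- rewrite diag1; apply/seq.permP => a.
  by have := seq.permP se a; have := seq.permP cu a; rewrite /= !count_cat; lia.
- rewrite diag2; apply/seq.permP => a.
  by have := seq.permP tf a; have := seq.permP cv a; rewrite /= !count_cat; lia.
Qed.

Lemma wassersteinE (s t : seq X) :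
  wasserstein p d A (sum_class A s) (sum_class A t) = matching_dist p d A s t.
Proof.
have [sE tE] := (termsK (sum_class A s), termsK (sum_class A t)).
rewrite /wasserstein !matching_distE; congr ereal_inf.
apply/seteqP; split=> b [c cM <-].
  have [c' c'M <-] := is_matching_sum_class sE tE cM.
  by exists c'.
have [c' c'M <-] := is_matching_sum_class (esym sE) (esym tE) cM.
by exists c'.
Qed.

End WassersteinTheory.

(* Main.v *)
Require Import Defs.
From HB Require Import structures.
From mathcomp Require Import all_boot all_order all_algebra.
From mathcomp Require Import zify.
From mathcomp Require Import all_classical all_reals all_analysis.

(** Up to the choice of representatives, W_p(s, t) is the infimum of the costs
of the matchings between the finite sums s and t, a matching being a list of
pairs whose first components are s plus points of A and whose second components
are t plus points of A. Every part of the theorem comes from an operation on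
matchings that is compatible with their cost: the diagonal gives
W_p(s, s) = 0, swapping the pairs gives symmetry, concatenating two matchings
gives p-subadditivity, gluing two matchings along their common middle sum gives
the triangle inequality, and applying a 1-Lipschitz f to both components of
each pair gives the estimate for f_*.

Two properties of the p-norm on nonnegative extended reals carry the
estimates. Minkowski's inequality ([minkowski_pnorm]) bounds the cost of a
glued matching by the sum of the two costs ([matching_glue]). A bound
x <= ||(a, b)||_p valid for all costs a and b of two families of matchings
passes to their infima ([le_pnorm_ereal_inf]); the latter is used with the
exponent p for subadditivity, and with the exponent 1, where the norm of a pair
is its sum, for the triangle inequality.

Functoriality is then read off on formal sums, since f_* applied to the class
of s is the class of the image of s. *)

Set Implicit Arguments.
Unset Strict Implicit.
Unset Printing Implicit Defensive.

Import Order.TTheory GRing.Theory Num.Theory.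

Local Open Scope classical_set_scope.
Local Open Scope ring_scope.
Local Open Scope ereal_scope.

(** * The p-norm of a finite tuple of extended reals *)

Section PNorm.
Context (R : realType) (p : \bar R).
Hypothesis p1 : 1 <= p.
Implicit Types (v w : seq (\bar R)) (x y : \bar R).

Lemma pexponent_gt0 (r : R) : 1 <= r%:E -> (0 < r)%R.
Proof. by rewrite lee_fin => /(lt_le_trans ltr01). Qed.

Lemma pnorm_ge0 v : 0 <= pnorm p v.
Proof.
case: p => [r| |] //=; first exact: poweR_ge0.
by elim/big_rec: _ => // x y _ y0; rewrite le_max y0 orbT.
Qed.

Lemma pnorm_nil : pnorm p [::] = 0.
Proof.
case: p p1 => [r /pexponent_gt0 r0|_|] //=; last by rewrite big_nil.
by rewrite big_nil poweR0r// gt_eqF// invr_gt0.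
Qed.

Lemma pnorm_seq1 x : pnorm p [:: x] = `|x|.
Proof.
case: p p1 => [r /pexponent_gt0 r0|_|] //=; last first.
  by rewrite big_cons big_nil max_l.
by rewrite big_cons big_nil adde0 -poweRrM divff ?gt_eqF// poweRe1.
Qed.

Lemma ler_pnorm_root (r : R) x y :
  (0 < r)%R -> 0 <= x -> x <= y -> poweR x r^-1 <= poweR y r^-1.
Proof.
move=> r0 x0 xy; apply: gt0_ler_poweR => //; rewrite ?in_itv/= ?leey ?andbT//.
- by rewrite invr_ge0 ltW.
- exact: le_trans xy.
Qed.

Lemma le_pnorm (T : eqType) (f g : T -> \bar R) (s : seq T) :
  {in s, forall z, `|f z| <= `|g z|} -> pnorm p (map f s) <= pnorm p (map g s).
Proof.
case: p p1 => [r /pexponent_gt0 r0|_|] //= fg; rewrite !big_map.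
  apply: ler_pnorm_root => //; first by apply: sume_ge0 => *; exact: poweR_ge0.
  rewrite big_seq [leRHS]big_seq; apply: lee_sum => z /fg fgz.
  by apply: gt0_ler_poweR; rewrite ?in_itv/= ?abse_ge0 ?leey//; exact: ltW.
elim: s fg => [|z s IHs] fg; first by rewrite !big_nil.
rewrite !big_cons ge_max !le_max fg ?mem_head//= IHs ?orbT// => z' z's.
by rewrite fg// in_cons z's orbT.
Qed.

Lemma le_pnorm_catr v w : pnorm p w <= pnorm p (v ++ w).
Proof.
by elim: v => //= x v /le_trans; apply; exact: le_pnorm_cons.
Qed.

Lemma le_pnorm_mem v x : x \in v -> `|x| <= pnorm p v.
Proof.
case/splitPr => v1 v2; rewrite -[x :: v2]cat1s catA.
rewrite (perm_pnorm p (_ : perm_eq _ ((v1 ++ v2) ++ [:: x]))).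
  by rewrite -pnorm_seq1 le_pnorm_catr.
by rewrite -!catA perm_cat2l perm_catC.
Qed.

(** This is what makes the cost of a concatenation of matchings a function of
the two costs, hence the source of p-subadditivity. *)
Lemma pnorm_cat v w : pnorm p (v ++ w) = pnorm p [:: pnorm p v; pnorm p w].
Proof.
have [v0 w0] := (pnorm_ge0 v, pnorm_ge0 w).
case: p p1 v0 w0 => [r /pexponent_gt0 r0|_|] //= v0 w0.
  have rK u : 0 <= u -> poweR `|poweR u r^-1| r = u.
    move=> u0; rewrite gee0_abs ?poweR_ge0// -poweRrM mulVf ?gt_eqF//.
    by rewrite poweRe1.
  rewrite big_cat !big_cons big_nil adde0 /= !rK//.
  - by apply: sume_ge0 => *; exact: poweR_ge0.
  - by apply: sume_ge0 => *; exact: poweR_ge0.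
rewrite !big_cons big_nil (max_l (abse_ge0 _)) !gee0_abs// {v0}.
elim: v => [|x v IHv]; first by rewrite big_nil max_r.
by rewrite cat_cons !big_cons IHv maxA.
Qed.

(** The p-norm of a tuple is the L^p norm of its extension by zero to nat for
the counting measure, so that integral inequalities apply to it. *)
Lemma pnorm_Lnorm_counting (r : R) (f : nat -> R) n : (0 < r)%R ->
  (forall k, (n <= k)%N -> f k = 0%R) ->
  Lnorm (@counting nat R) r%:E (EFin \o f)
  = pnorm r%:E [seq (f k)%:E | k <- index_iota 0 n].
Proof.
move=> r0 f0; rewrite Lnorm_counting//= big_map; congr poweR.
rewrite (nneseries_split 0 n) => [|k _]; last by rewrite lee_fin powR_ge0.
rewrite add0n eseries0 ?adde0// => k nk _.
by rewrite /= f0// normr0 powR0// gt_eqF.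
Qed.

Lemma minkowski_pnorm_fin (r : R) (T : Type) (f g : T -> R) (s : seq T) :
  (1 <= r)%R ->
  pnorm r%:E [seq (f z + g z)%:E | z <- s] <=
  pnorm r%:E [seq (f z)%:E | z <- s] + pnorm r%:E [seq (g z)%:E | z <- s].
Proof.
move=> r1; have r0 : (0 < r)%R by exact: lt_le_trans r1.
pose ext (h : T -> R) k := nth 0%R (map h s) k.
have extE h : Lnorm (@counting nat R) r%:E (EFin \o ext h)
    = pnorm r%:E [seq (h z)%:E | z <- s].
  rewrite (pnorm_Lnorm_counting (n := size s))// => [|k sk]; last first.
    by rewrite /ext nth_default// size_map.
  rewrite (map_comp EFin (ext h)) (map_comp EFin h); congr (pnorm _ (map _ _)).
  by rewrite -[RHS](mkseq_nth 0%R) size_map /mkseq /index_iota subn0.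
rewrite -!extE.
have -> : ext (fun z => f z + g z)%R = (ext f \+ ext g)%R.
  apply/funext => k; rewrite /ext /= {ext extE}.
  by elim: s k => [|z s IHs] [|k] //=; rewrite addr0.
exact: minkowski_EFin.
Qed.

Lemma map_EFin_fine (T : eqType) (f : T -> \bar R) (s : seq T) :
  (forall z, 0 <= f z) -> pnorm p (map f s) < +oo ->
  map f s = [seq (fine (f z))%:E | z <- s].
Proof.
move=> f0 foo; apply/eq_in_map => z zs; rewrite fineK//.
rewrite ge0_fin_numE// (le_lt_trans _ foo)// -[leLHS]gee0_abs//.
by rewrite le_pnorm_mem// map_f.
Qed.

(** For finite p, an infinite entry of f or g makes the right-hand side
infinite, so only real entries are left, which is [minkowski_pnorm_fin]; for
p = +oo the inequality is the triangle inequality entry by entry. *)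
Lemma minkowski_pnorm (T : eqType) (f g : T -> \bar R) (s : seq T) :
  (forall z, 0 <= f z) -> (forall z, 0 <= g z) ->
  pnorm p [seq f z + g z | z <- s] <= pnorm p (map f s) + pnorm p (map g s).
Proof.
move=> f0 g0; have := @map_EFin_fine T f s f0; have := @map_EFin_fine T g s g0.
have := pnorm_ge0 (map f s); have := pnorm_ge0 (map g s).
case: p p1 => [r r1|_|] // gs0 fs0 gfin ffin; last first.
  rewrite /= !big_map; elim: s {gs0 fs0 gfin ffin} => [|z s IHs].
    by rewrite !big_nil adde0.
  rewrite !big_cons ge_max; apply/andP; split.
    by rewrite (le_trans (lee_abs_add _ _))// leeD// le_max lexx.
  by rewrite (le_trans IHs)// leeD// le_max lexx orbT.
have [foo|] := ltP (pnorm r%:E (map f s)) +oo; last first.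
  rewrite leye_eq => /eqP ->.
  by rewrite addye ?leey// gt_eqF// (lt_le_trans _ gs0).
have [goo|] := ltP (pnorm r%:E (map g s)) +oo; last first.
  rewrite leye_eq => /eqP ->.
  by rewrite addey ?leey// gt_eqF// (lt_le_trans _ fs0).
rewrite ffin// gfin//.
apply: le_trans (minkowski_pnorm_fin _ _ _ _) => //.
suff -> : [seq f z + g z | z <- s] =
  [seq (fine (f z) + fine (g z))%:E | z <- s] by [].
apply/eq_in_map => z zs; rewrite EFinD.
have /eq_in_map -> // := ffin foo; by have /eq_in_map -> := gfin goo.
Qed.

Lemma minkowski_pnorm2 x x' y y' : 0 <= x -> 0 <= x' -> 0 <= y -> 0 <= y' ->
  pnorm p [:: x + x'; y + y'] <= pnorm p [:: x; y] + pnorm p [:: x'; y'].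
Proof.
move=> x0 x'0 y0 y'0.
by have := @minkowski_pnorm bool (fun b => if b then x else y)
  (fun b => if b then x' else y') [:: true; false]; apply; case.
Qed.

Lemma le_pnorm2 x x' y y' : 0 <= x -> 0 <= y -> x <= x' -> y <= y' ->
  pnorm p [:: x; y] <= pnorm p [:: x'; y'].
Proof.
move=> x0 y0 xx' yy'.
have := @le_pnorm bool (fun b => if b then x else y)
  (fun b => if b then x' else y') [:: true; false]; apply=> -[] _.
  by rewrite !gee0_abs// (le_trans x0).
by rewrite !gee0_abs// (le_trans y0).
Qed.

Lemma pnorm_pairC x y : pnorm p [:: x; y] = pnorm p [:: y; x].
Proof. by apply/perm_pnorm/permPl => v; rewrite -cat1s perm_catC. Qed.

(** When both infima are finite, they are approached within e / 2 by some a and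
b, and Minkowski's inequality gives
||(inf S + e/2, inf T + e/2)|| <= ||(inf S, inf T)|| + ||(e/2, e/2)||, where
the last norm is at most ||(e/2, 0)|| + ||(0, e/2)|| = e. *)
Lemma le_pnorm_ereal_inf (S T : set (\bar R)) x :
  (forall a, S a -> 0 <= a) -> (forall b, T b -> 0 <= b) ->
  (forall a b, S a -> T b -> x <= pnorm p [:: a; b]) ->
  x <= pnorm p [:: ereal_inf S; ereal_inf T].
Proof.
move=> S0 T0 xST.
have iS0 : 0 <= ereal_inf S by exact/ereal_infP.
have iT0 : 0 <= ereal_inf T by exact/ereal_infP.
(* An infinite infimum makes the right-hand side infinite. *)
have inf_mem y v : y \in v -> +oo <= y -> x <= pnorm p v.
  move=> /le_pnorm_mem yv; rewrite leye_eq => /eqP yoo.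
  by apply: le_trans (leey x) _; move: yv; rewrite yoo.
have [Soo|] := ltP (ereal_inf S) +oo; last first.
  by apply: inf_mem; rewrite !inE eqxx.
have [Too|] := ltP (ereal_inf T) +oo; last first.
  by apply: inf_mem; rewrite !inE eqxx orbT.
apply/lee_addgt0Pr => e e0; have e20 : (0 < e / 2)%R by rewrite divr_gt0.
have Sfin : ereal_inf S \is a fin_num by rewrite ge0_fin_numE.
have Tfin : ereal_inf T \is a fin_num by rewrite ge0_fin_numE.
have [a Sa /ltW ae] := lb_ereal_inf_adherent e20 Sfin.
have [b Tb /ltW be] := lb_ereal_inf_adherent e20 Tfin.
have e2 : 0 <= (e / 2)%:E by rewrite lee_fin ltW.
apply: le_trans (xST a b Sa Tb) _.
apply: le_trans (le_pnorm2 (S0 a Sa) (T0 b Tb) ae be) _.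
apply: le_trans (minkowski_pnorm2 _ _ _ _) _ => //.
rewrite leeD2l//.
have := @minkowski_pnorm2 (e / 2)%:E 0 0 (e / 2)%:E e2 (lexx _) (lexx _) e2.
rewrite adde0 add0e [X in _ + X](pnorm_cons0 p1) pnorm_pairC (pnorm_cons0 p1).
rewrite pnorm_seq1 => /le_trans; apply.
by rewrite gee0_abs// -EFinD -splitr.
Qed.

End PNorm.

(** * Operations on matchings and the metric monoid structure *)

Section WassersteinMetric.
Context (R : realType) (p : \bar R) (X : Type) (d : X -> X -> \bar R).
Context (A : set X).
Hypotheses (p1 : 1 <= p) (dP : is_metric d) (A0 : A !=set0).
Let X' : choiceType := {classic X}.
Implicit Types (s t u v : seq X') (c : seq (X' * X')).

Notation W := (wasserstein p d A).
Notation cost := (matching_cost p d).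

Lemma wasserstein_infE s t :
  W (sum_class A s) (sum_class A t)
  = ereal_inf [set cost c | c in is_matching A s t].
Proof. by rewrite wassersteinE// matching_distE. Qed.

Lemma wasserstein_le_cost s t c :
  is_matching A s t c -> W (sum_class A s) (sum_class A t) <= cost c.
Proof.
by move=> cM; rewrite wasserstein_infE; apply: ereal_inf_lbound; exists c.
Qed.

Lemma matching_cost_ge0 c : 0 <= cost c.
Proof. exact: pnorm_ge0. Qed.

#[local] Hint Resolve matching_cost_ge0 : core.

(** Matching points of A with themselves is free; this is how the two matchings
in [matching_glue] are brought to a common middle list. *)
Lemma matching_extend s t c w : all (mem A) w -> is_matching A s t c ->
  is_matching A s t ([seq (x, x) | x <- w] ++ c).
Proof.
elim: w => //= x w IHw /andP[Ax Aw] cM; apply: matching_pad.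
  exact: set_mem.
exact: IHw.
Qed.

Lemma matching_cost_extend c w : cost ([seq (x, x) | x <- w] ++ c) = cost c.
Proof. by elim: w => //= x w; rewrite matching_cost_pad. Qed.

Lemma matching_diag s : is_matching A s s [seq (x, x) | x <- s].
Proof.
exists [::], [::]; split=> //.
  by rewrite cats0 /unzip1 -map_comp map_id.
by rewrite cats0 /unzip2 -map_comp map_id.
Qed.

Lemma matching_cost_diag s : cost [seq (x, x) | x <- s] = 0.
Proof.
by rewrite -[map _ s]cats0 matching_cost_extend; exact: pnorm_nil.
Qed.

Definition swap_pairs c : seq (X' * X') := [seq (z.2, z.1) | z <- c].

Lemma matching_swap s t c :
  is_matching A s t c -> is_matching A t s (swap_pairs c).
Proof.
move=> [u [v [Au Av cu cv]]]; exists v, u; split=> //.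
  by rewrite /unzip1 -map_comp.
by rewrite /unzip2 -map_comp.
Qed.

Lemma matching_cost_swap c : cost (swap_pairs c) = cost c.
Proof.
rewrite /matching_cost -map_comp; congr pnorm.
by apply: eq_map => -[x y] /=; rewrite Defs.metric_sym.
Qed.

Lemma matching_cat s s' t t' c c' :
  is_matching A s t c -> is_matching A s' t' c' ->
  is_matching A (s ++ s') (t ++ t') (c ++ c').
Proof.
move=> [u [v [Au Av cu cv]]] [u' [v' [Au' Av' cu' cv']]].
exists (u ++ u'), (v ++ v'); rewrite !all_cat Au Av Au' Av'; split=> //.
  by rewrite /unzip1 map_cat perm_sym perm_catACA perm_sym perm_cat.
by rewrite /unzip2 map_cat perm_sym perm_catACA perm_sym perm_cat.
Qed.

Lemma matching_cost_cat c c' : cost (c ++ c') = pnorm p [:: cost c; cost c'].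
Proof. by rewrite /matching_cost map_cat pnorm_cat. Qed.

(** The middle list of c is t plus points v of A, that of c' is t plus points
u' of A. After adding the free pairs over u' to c and those over v to c', both
middle lists are t + u' + v up to order, so the pairs of c' can be permuted to
continue those of c. Composing them pairwise gives a matching whose distances
are bounded by the sums of two distances, and Minkowski's inequality applies. *)
Lemma matching_glue s t w c c' :
  is_matching A s t c -> is_matching A t w c' ->
  exists2 c'', is_matching A s w c'' & cost c'' <= cost c + cost c'.
Proof.
move=> [u [v [Au Av cu cv]]] [u' [v' [Au' Av' cu' cv']]].
pose c1 := [seq (x, x) | x <- u'] ++ c.
pose c2 := [seq (x, x) | x <- v] ++ c'.
have c12 : perm_eq (unzip1 c2) (unzip2 c1).
  rewrite /c1 /c2 /unzip1 /unzip2 !map_cat -!map_comp !map_id.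
  apply/seq.permP => a.
  have := seq.permP cv a; have := seq.permP cu' a; rewrite !count_cat.
  by rewrite /unzip1 /unzip2 => -> ->; lia.
have [c2' c2'c2 c2'E] : exists2 c2', perm_eq c2' c2 & unzip1 c2' = unzip2 c1.
  by apply: perm_map_lift; rewrite perm_sym.
have sc12 : size c1 = size c2'.
  by rewrite -(size_map snd) -/(unzip2 c1) -c2'E size_map.
pose z := zip c1 c2'.
have z1 : map fst z = c1 by exact/unzip1_zip/eq_leq.
have z2 : map snd z = c2' by apply/unzip2_zip; rewrite sc12.
have zmid : {in z, forall y, y.1.2 = y.2.1}.
  apply/eq_in_map; rewrite (map_comp snd fst) (map_comp fst snd) z1 z2.
  exact: esym c2'E.
exists [seq (y.1.1, y.2.2) | y <- z].
  exists (u' ++ u), (v ++ v'); rewrite !all_cat Au Au' Av Av'; split=> //.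
    rewrite /unzip1 -map_comp.
    rewrite (map_comp fst fst) z1 /c1 map_cat -map_comp map_id.
    apply/seq.permP => a; have := seq.permP cu a.
    by rewrite /unzip1 !count_cat => ->; lia.
  rewrite /unzip2 -map_comp.
  rewrite (map_comp snd snd) z2 (permPl (perm_map _ c2'c2)).
  rewrite /c2 map_cat -map_comp map_id.
  apply/seq.permP => a; have := seq.permP cv' a.
  by rewrite /unzip2 !count_cat => ->; lia.
rewrite -(matching_cost_extend c u') -(matching_cost_extend c' v) -/c1 -/c2.
rewrite [cost c2](perm_pnorm p (perm_map _ (_ : perm_eq c2 c2'))); last first.
  by rewrite perm_sym.
rewrite /matching_cost -z1 -z2 -!map_comp.
apply: le_trans (minkowski_pnorm p1 _ _ _); last 2 first.
- by move=> y; exact: Defs.metric_ge0.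
- by move=> y; exact: Defs.metric_ge0.
apply: le_pnorm => // y yz /=; rewrite !gee0_abs ?adde_ge0 ?Defs.metric_ge0//.
by rewrite -zmid//; exact: Defs.metric_triangle.
Qed.

Lemma wasserstein_is_metric : is_metric W.
Proof.
split=> [a b|a|a b|a b e].
- by apply/ereal_infP => _ [x [x' [sigma [_ _ ->]]]]; exact: pnorm_ge0.
- rewrite -(termsK a); apply/le_anti/andP; split.
    rewrite -(matching_cost_diag (terms a)).
    exact/wasserstein_le_cost/matching_diag.
  by rewrite wasserstein_infE; apply/ereal_infP => _ [c _ <-].
- have le a' b' : W a' b' <= W b' a'; last by apply/eqP; rewrite eq_le !le.
  rewrite -(termsK a') -(termsK b') [leRHS]wasserstein_infE.
  apply/ereal_infP => _ [c cM <-].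
  by rewrite -matching_cost_swap; exact/wasserstein_le_cost/matching_swap.
- rewrite -(termsK a) -(termsK b) -(termsK e).
  rewrite [X in _ <= X + _]wasserstein_infE [X in _ <= _ + X]wasserstein_infE.
  (* The sum of two costs is their 1-norm, whatever the exponent p. *)
  have p11 : 1 <= 1%:E :> \bar R by [].
  have norm1 x y : 0 <= x -> 0 <= y -> pnorm 1%:E [:: x; y] = x + y :> \bar R.
    move=> x0 y0; rewrite /= !big_cons big_nil invr1 adde0 !gee0_abs//.
    by rewrite !poweRe1 ?adde_ge0.
  have inf_ge0 s t : 0 <= ereal_inf [set cost c | c in is_matching A s t].
    by apply/ereal_infP => _ [c _ <-].
  rewrite -norm1//; apply: (le_pnorm_ereal_inf p11).
  + by move=> _ [c _ <-].
  + by move=> _ [c _ <-].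
  + move=> _ _ [c cM <-] [c' c'M <-]; rewrite norm1 ?matching_cost_ge0//.
    have [c'' c''M] := matching_glue cM c'M; apply: le_trans.
    exact: wasserstein_le_cost.
Qed.

Lemma wasserstein_psubadditive : is_psubadditive p W.
Proof.
split; first exact: wasserstein_is_metric.
move=> a b a' b'; rewrite -(termsK a) -(termsK b) -(termsK a') -(termsK b').
rewrite [W (sum_class A (terms a)) _]wasserstein_infE.
rewrite [W (sum_class A (terms b)) _]wasserstein_infE.
apply: (le_pnorm_ereal_inf p1).
- by move=> _ [c _ <-].
- by move=> _ [c _ <-].
- move=> _ _ [c cM <-] [c' c'M <-]; rewrite -!sum_class_cat -matching_cost_cat.
  exact/wasserstein_le_cost/matching_cat.
Qed.

Lemma rel_incl_pair_map : is_pair_map d A W [set 0%R] (rel_incl A).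
Proof.
split=> [x y|_ [x Ax <-]].
  rewrite -[leRHS]gee0_abs ?Defs.metric_ge0// -(pnorm_seq1 p1).
  apply: (@wasserstein_le_cost [:: x] [:: y] [:: (x, y)]).
  by exists [::], [::].
rewrite /= -(sum_class_nil A); apply/(@sum_class_eqP _ _ [:: x] [::]).
exists [::], [:: x]; split=> //=; rewrite andbT; exact: mem_set.
Qed.

End WassersteinMetric.

(** * Functoriality *)

Lemma rel_push_id (X : Type) (A : set X) : rel_push A A id =1 id.
Proof. by move=> a; rewrite /rel_push map_id termsK. Qed.

Lemma rel_push_comp (X Y Z : Type) (A : set X) (B : set Y) (C : set Z)
    (f : X -> Y) (g : Y -> Z) :
  g @` B `<=` C ->
  rel_push A C (g \o f) =1 rel_push B C g \o rel_push A B f.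
Proof.
by move=> gBC a; rewrite /= [rel_push A B f a]/rel_push rel_pushE// -map_comp.
Qed.

Section Functoriality.
Context (R : realType) (p : \bar R).
Hypothesis p1 : 1 <= p.
Implicit Types P Q : metric_pair R.

(** As f maps A into B and does not increase distances, it carries a matching
of s and t to one of their images, at no greater cost. *)
Lemma rel_push_metric_monoid_hom P Q (f : pair_map P Q) :
  is_metric_monoid_hom
    (wasserstein p (pair_dist P) (pair_sub P))
    (wasserstein p (pair_dist Q) (pair_sub Q))
    (rel_push (pair_sub P) (pair_sub Q) f).
Proof.
have [fd fA] := pair_funP f.
have [dP dQ] := (pair_metric P, pair_metric Q).
have [P0 Q0] := (pair_sub_neq0 P, pair_sub_neq0 Q).
have push0 : rel_push (pair_sub P) (pair_sub Q) f 0%R = 0%R.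
  by rewrite -(sum_class_nil (pair_sub P)) rel_pushE//= sum_class_nil.
split; last first.
  split=> // a b; rewrite -(termsK a) -(termsK b) -sum_class_cat !rel_pushE//.
  by rewrite map_cat sum_class_cat.
split=> [a b|_ [_ -> <-]//].
rewrite -(termsK a) -(termsK b) !rel_pushE// [leRHS]wasserstein_infE//.
apply/ereal_infP => _ [c [u [v [Au Av cu cv]]] <-].
have fAll w : all (mem (pair_sub P)) w -> all (mem (pair_sub Q)) (map f w).
  rewrite all_map; apply: sub_all => x /set_mem Ax.
  by apply/mem_set/fA; exists x.
pose fc : seq ({classic Q} * {classic Q}) := [seq (f z.1, f z.2) | z <- c].
apply: (@le_trans _ _ (matching_cost p (pair_dist Q) fc)).
  apply: wasserstein_le_cost => //; exists (map f u), (map f v).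
  split; [exact: fAll|exact: fAll| |].
    rewrite /unzip1 -map_comp -map_cat.
    rewrite (map_comp (f : {classic P} -> {classic Q}) fst).
    exact: perm_map.
  rewrite /unzip2 -map_comp -map_cat.
  rewrite (map_comp (f : {classic P} -> {classic Q}) snd).
  exact: perm_map.
rewrite /matching_cost -map_comp.
apply: (@le_pnorm R p p1 ({classic P} * {classic P})%type) => z _.
by rewrite /= !gee0_abs ?Defs.metric_ge0//; exact: fd.
Qed.

End Functoriality.

Theorem proposition1p1 (R : realType) (p : \bar R) (p1 : (1 <= p)%E) :
  exists D_ok : forall P : metric_pair R,
      is_psubadditive p (wasserstein p (pair_dist P) (pair_sub P)),
    (forall P : metric_pair R,
       is_pair_map (pair_dist P) (pair_sub P)
         (wasserstein p (pair_dist P) (pair_sub P)) [set 0%R]%classic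
         (rel_incl (pair_sub P))) /\
    exists push_ok : forall (P Q : metric_pair R) (f : pair_map P Q),
        is_metric_monoid_hom
          (wasserstein p (pair_dist P) (pair_sub P))
          (wasserstein p (pair_dist Q) (pair_sub Q))
          (rel_push (pair_sub P) (pair_sub Q) f),
      @is_functor (metric_pairs R) (metric_monoids p)
        (fun P : metric_pair R => MetricMonoid (D_ok P))
        (fun (P Q : metric_pair R) (f : pair_map P Q) =>
           @MetricMonoidHom R p (MetricMonoid (D_ok P)) (MetricMonoid (D_ok Q))
             (rel_push (pair_sub P) (pair_sub Q) f) (push_ok P Q f)).
Proof.
exists (fun P => wasserstein_psubadditive p1 (pair_metric P) (pair_sub_neq0 P)).
split=> [P|].
  exact: rel_incl_pair_map p1 (pair_metric P) (pair_sub_neq0 P).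
exists (fun P Q f => rel_push_metric_monoid_hom p1 f).
split=> [P|P Q S g f]; apply: metric_monoid_hom_eq => a /=.
  exact: rel_push_id.
by apply: rel_push_comp; exact: (pair_funP g).2.
Qed.
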